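(* Let $R$ be a commutative ring with non-zero identity, $I$ an ideal of $R$, $M$ an $R$-module and $N$ a submodule of $M$. (1) If $I(+)N$ is a weakly $J$-ideal of the idealization ring $R(+)M$, then $I$ is a weakly $J$-ideal of $R$. (2) $I(+)M$ is a weakly $J$-ideal of $R(+)M$ if and only if $I$ is a weakly $J$-ideal of $R$ and, for all $x,y\in R$ with $xy=0$, $x\notin J(R)$ and $y\notin I$, one has $x,y\in \mathrm{Ann}(M)$.
   Context: $J(A)$ denotes the Jacobson radical of a ring $A$. The idealization $R(+)M=\{(r,m): r\in R, m\in M\}$ is the commutative ring with coordinate-wise addition and multiplication $(r_1,m_1)(r_2,m_2)=(r_1r_2,\, r_1m_2+r_2m_1)$, with identity $(1,0)$. $I(+)N=\{(r,m): r\in I, m\in N\}$; it is an ideal of $R(+)M$ if and only if $IM\subseteq N$. $\mathrm{Ann}(M)=\{r\in R: rM=0\}$. A proper ideal $I$ of a ring $A$ is a weakly $J$-ideal if whenever $a,b\in A$ with $0\neq ab\in I$ and $a\notin J(A)$, then $b\in I$. *)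

(* Defs.v *)
From HB Require Import structures.
From mathcomp Require Import all_boot all_order all_algebra.
From mathcomp Require Import ring_quotient.
From mathcomp Require Import boolp classical_sets.

Set Implicit Arguments.
Unset Strict Implicit.
Unset Printing Implicit Defensive.

Import GRing.Theory.
Local Open Scope ring_scope.
Local Open Scope classical_set_scope.

Section Ideals.
Variable A : comNzRingType.
Implicit Types I P Q : set A.

(* [submod_closed] over the regular module [A^o]: here [I = A] is allowed,
   whereas MathComp's [idealr_closed] includes [1 \notin I]. *)
Definition is_ideal I : Prop := GRing.submod_closed (mem I : {pred A^o}).

Definition is_proper_ideal I : Prop := idealr_closed (mem I).

Definition is_maximal_ideal P : Prop :=
  is_proper_ideal P /\ forall Q, is_proper_ideal Q -> P `<=` Q -> Q = P.

Definition jacobson : set A := \bigcap_(P in is_maximal_ideal) P.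

Definition weakly_J_ideal I : Prop :=
  is_proper_ideal I /\
  forall a b : A, a * b != 0 -> I (a * b) -> ~ jacobson a -> I b.

End Ideals.

Arguments jacobson A : clear implicits.

Definition is_submodule (R : comNzRingType) (M : lmodType R) (N : set M) : Prop :=
  GRing.submod_closed (mem N).

Definition annihilator (R : comNzRingType) (M : lmodType R) : set R :=
  [set r | forall m : M, r *: m = 0].

(* An alias of [R * M], so that its multiplication is not mistaken for the
   componentwise one of a product of rings. *)
Definition idealization (R : comNzRingType) (M : lmodType R) : Type :=
  (R * M)%type.

Section Idealization.
Variables (R : comNzRingType) (M : lmodType R).
Local Notation RM := (idealization M).

HB.instance Definition _ := GRing.Zmodule.copy RM (R * M)%type.

Definition idealization_one : RM := (1, 0).
Definition idealization_mul (x y : RM) : RM :=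
  (x.1 * y.1, x.1 *: y.2 + y.1 *: x.2).

Fact idealization_mulA : associative idealization_mul.
Proof.
move=> x y z; congr pair; rewrite /= ?mulrA //.
by rewrite !scalerDr !scalerA addrA [z.1 * x.1]mulrC [z.1 * y.1]mulrC.
Qed.

Fact idealization_mulC : commutative idealization_mul.
Proof. by move=> x y; congr pair; rewrite /= 1?mulrC 1?addrC. Qed.

Fact idealization_mul1 : left_id idealization_one idealization_mul.
Proof.
by case=> r m; congr pair; rewrite /= ?mul1r // scale1r scaler0 addr0.
Qed.

Fact idealization_mulDl : left_distributive idealization_mul +%R.
Proof.
move=> x y z; congr pair; rewrite /= ?mulrDl //.
by rewrite scalerDl scalerDr addrACA.
Qed.

Fact idealization_oner_neq0 : idealization_one != 0.
Proof. by apply/eqP => -[/eqP]; rewrite oner_eq0. Qed.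

HB.instance Definition _ := GRing.Zmodule_isComNzRing.Build RM
  idealization_mulA idealization_mulC idealization_mul1 idealization_mulDl
  idealization_oner_neq0.

Definition idealize (I : set R) (N : set M) : set RM := I `*` N.

End Idealization.

(* Main.v *)
Require Import Defs.
From mathcomp Require Import all_boot all_order all_algebra.
From mathcomp Require Import boolp classical_sets.

(* The elements (1, m) are units of R(+)M, with inverse (1, -m); hence the
   projection of a proper ideal Q to R is a proper ideal P, and Q is contained
   in P(+)M.  So the maximal ideals of R(+)M are the P(+)M with P maximal, and
   J(R(+)M) = J(R)(+)M.  For (1), lift a product a b to (a, 0)(b, 0).  For (2),
   the products not controlled by I are the (x, m)(y, n) = (0, x n + y m) with
   x y = 0; if x is not in J(R) and y is not in I, they vanish for all m and n
   exactly when x and y annihilate M. *)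

Import GRing.Theory.
Local Open Scope ring_scope.
Local Open Scope classical_set_scope.

(** Trades the boolean membership of [idealr_closed] for plain propositions. *)
Lemma is_proper_idealP (A : comNzRingType) (I : set A) :
  is_proper_ideal I <->
  [/\ I 0, ~ I 1 & forall a u v, I u -> I v -> I (a * u + v)].
Proof.
split=> [[I0 I1 IDM]|[I0 I1 IDM]]; split.
- by move: I0; rewrite inE.
- by move/mem_set => I1'; move: I1; rewrite I1'.
- by move=> a u v /mem_set Iu /mem_set Iv; apply: set_mem; exact: IDM.
- by rewrite inE.
- by apply/negP; rewrite inE.
- by move=> a u v; rewrite !inE; exact: IDM.
Qed.

(** Scaling in [A^o] is multiplication, so the two closure conditions agree and only [1 \notin I]
    has to be added. *)
Lemma is_ideal_proper {A : comNzRingType} {I : set A} :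
  is_ideal I -> ~ I 1 -> is_proper_ideal I.
Proof.
by move=> [I0 IDM] I1; split=> //; apply/negP; rewrite inE.
Qed.

Section IdealsOfIdealization.
Context {R : comNzRingType} {M : lmodType R}.
Implicit Types (P : set R) (Q : set (idealization M)).

Lemma is_proper_ideal_idealize P :
  is_proper_ideal (idealize P [set: M]) <-> is_proper_ideal P.
Proof.
split=> /is_proper_idealP[P0 P1 PDM]; apply/is_proper_idealP; split.
- by case: P0.
- by move=> P1'; apply: P1; split.
- by move=> a u v Pu Pv; case: (PDM (a, 0) (u, 0) (v, 0)).
- by split.
- by case.
- by move=> a u v [Pu _] [Pv _]; split=> //; exact: PDM.
Qed.

Lemma is_proper_ideal_fst Q : is_proper_ideal Q -> is_proper_ideal (fst @` Q).
Proof.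
move=> /is_proper_idealP[Q0 Q1 QDM]; apply/is_proper_idealP; split.
- by exists 0.
- case=> -[r m] Qrm /= r1; rewrite r1 in Qrm; apply: Q1.
  (* The summand 0 gives the product the shape [a * u + v] expected by [QDM]. *)
  have -> : 1 = ((1, - m) : idealization M) * (1, m) + 0.
    by rewrite addr0; congr pair; rewrite /= ?mulr1 // !scale1r subrr.
  exact: QDM.
- move=> a _ _ [u Qu <-] [v Qv <-].
  by exists (((a, 0) : idealization M) * u + v) => //; exact: QDM.
Qed.

Lemma sub_idealize_fst Q : Q `<=` idealize (fst @` Q) [set: M].
Proof. by move=> z Qz; split=> //; exists z. Qed.

Lemma idealizeT_inj P1 P2 :
  idealize P1 [set: M] = idealize P2 [set: M] -> P1 = P2.
Proof.
move=> eqP12; apply/funext => r; apply/propext; split=> Pr.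
  have [] // : idealize P2 [set: M] (r, 0) by rewrite -eqP12; split.
have [] // : idealize P1 [set: M] (r, 0) by rewrite eqP12; split.
Qed.

Lemma is_maximal_ideal_idealize P :
  is_maximal_ideal P -> is_maximal_ideal (idealize P [set: M]).
Proof.
move=> [properP maxP]; split; first exact/is_proper_ideal_idealize.
move=> Q properQ subQ; apply/seteqP; split=> // z Qz.
(* Maximality of P identifies it with the projection of Q, a proper ideal containing P. *)
rewrite -(maxP (fst @` Q)); first exact: sub_idealize_fst.
  exact: is_proper_ideal_fst.
by move=> r Pr; exists (r, 0) => //; apply: subQ; split.
Qed.

Lemma maximal_ideal_idealization Q : is_maximal_ideal Q ->
  exists2 P, is_maximal_ideal P & Q = idealize P [set: M].
Proof.
move=> [properQ maxQ]; have properP := is_proper_ideal_fst _ properQ.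
have QE : idealize (fst @` Q) [set: M] = Q.
  by apply: maxQ; [exact/is_proper_ideal_idealize | exact: sub_idealize_fst].
(* The projection is maximal: if P' is proper and contains it, then P'(+)M is proper and contains Q,
   hence equals Q. *)
exists (fst @` Q) => //; split=> // P' properP' subP'.
apply: idealizeT_inj; rewrite QE; apply: maxQ.
  exact/is_proper_ideal_idealize.
by move=> z Qz; split=> //; apply: subP'; exists z.
Qed.

Lemma jacobson_idealization :
  jacobson (idealization M) = idealize (jacobson R) [set: M].
Proof.
apply/seteqP; split=> z.
  move=> Jz; split=> // P maxP.
  by have [] := Jz _ (is_maximal_ideal_idealize _ maxP).
move=> [Jz _] Q /maximal_ideal_idealization[P maxP ->].
by split=> //; exact: Jz.
Qed.

Lemma not_jacobson_idealization (r : R) (m : M) :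
  ~ jacobson (idealization M) (r, m) <-> ~ jacobson R r.
Proof.
rewrite jacobson_idealization; split=> nJ Jr; apply: nJ; first by split.
by case: Jr.
Qed.

Lemma weakly_J_ideal_idealize (I : set R) (N : set M) :
  is_ideal I -> N 0 -> weakly_J_ideal (idealize I N) -> weakly_J_ideal I.
Proof.
move=> idI N0 [/is_proper_idealP[_ IN1 _] wJ]; split.
  by apply: (is_ideal_proper idI) => I1; apply: IN1; split.
move=> a b ab0 Iab /(not_jacobson_idealization a 0) nJa.
have abE : ((a, 0) : idealization M) * (b, 0) = (a * b, 0).
  by congr pair; rewrite /= !scaler0 addr0.
have [] // := wJ (a, 0) (b, 0) _ _ nJa; rewrite abE //.
by apply: contra_neq ab0 => -[].
Qed.

Lemma weakly_J_ideal_idealizeT_ann (I : set R) (x y : R) :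
  weakly_J_ideal (idealize I [set: M]) ->
  x * y = 0 -> ~ jacobson R x -> ~ I y -> annihilator M x /\ annihilator M y.
Proof.
move=> [/is_proper_idealP[[I0 _] _ _] wJ] xy0 nJx nIy.
(* Otherwise (x, m)(y, n) is a nonzero element of I(+)M with (x, m) outside the radical, which
   forces y into I. *)
have xmyn (m n : M) : x *: n + y *: m = 0.
  apply/eqP/negPn/negP => neq0; apply: nIy.
  have zE : ((x, m) : idealization M) * (y, n) = (0, x *: n + y *: m).
    by congr pair.
  have [] // := wJ (x, m) (y, n); last exact/not_jacobson_idealization.
    by rewrite zE; apply: contra_neq neq0 => -[].
  by rewrite zE; split.
(* Setting one of the two module elements to 0 isolates the other term. *)
by split=> m; [have := xmyn 0 m | have := xmyn m 0];
  rewrite scaler0 ?addr0 ?add0r.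
Qed.

Lemma weakly_J_ideal_idealizeT (I : set R) :
  weakly_J_ideal I ->
  (forall x y : R, x * y = 0 -> ~ jacobson R x -> ~ I y ->
     annihilator M x /\ annihilator M y) ->
  weakly_J_ideal (idealize I [set: M]).
Proof.
move=> [properI wJ] annI; split; first exact/is_proper_ideal_idealize.
move=> [a m] [b n] ab0 [Iab _] /not_jacobson_idealization nJa; split=> //=.
(* A nonzero product in R(+)M may have first coordinate 0, where [wJ] says nothing; there [annI]
   makes the second coordinate vanish too. *)
have [abr0|abr0] := eqVneq (a * b) 0; last exact: (wJ a).
apply: contrapT => nIb; have [annA annB] := annI a b abr0 nJa nIb.
case/eqP: ab0; congr pair => //=.
by rewrite annA annB addr0.
Qed.

End IdealsOfIdealization.

Theorem theorem5 (R : comNzRingType) (I : set R) (M : lmodType R) (N : set M)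
    (hI : is_ideal I) (hN : is_submodule N) :
  (weakly_J_ideal (idealize I N) -> weakly_J_ideal I) /\
  (weakly_J_ideal (idealize I [set: M]) <->
   weakly_J_ideal I /\
   forall x y : R, x * y = 0 -> ~ jacobson R x -> ~ I y ->
     annihilator M x /\ annihilator M y).
Proof.
split; first by apply: weakly_J_ideal_idealize => //; case: hN; rewrite inE.
split=> [wJ|[wJ annI]]; last exact: weakly_J_ideal_idealizeT.
(* This is the first part with N = M; [Logic.I] proves that 0 lies in [[set: M]]. *)
split; first exact: (weakly_J_ideal_idealize _ _ hI Logic.I wJ).
by move=> x y; exact: weakly_J_ideal_idealizeT_ann.
Qed.
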